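(* For real $k$ let $S_k(x,y)=y^2+(x^2+kx+1)y+x^3$. Let $\theta\in[-\pi,\pi]$ and $x=e^{i\theta}$. There is a $y$ with $|y|=1$ and $S_k(e^{i\theta},y)=0$ if and only if one of the following holds: (i) $\theta=0$ and $|k+2|\le 2$; (ii) $k+2\cos\theta=0$ (solvable in $\theta$ if and only if $|k|\le 2$). Consequently: (1) the torus $\{|x|=|y|=1\}$ meets the curve $S_k=0$ if and only if $k\in[-4,2]$; (2) for $-2\le k\le 2$ the fold points $\theta=\pm\arccos(-k/2)$ occur, at which $x^2+kx+1=0$ and the equation $S_k(e^{i\theta},y)=0$ becomes $y^2=-x^3$, with both roots of modulus $1$; (3) for $-4\le k\le 0$ an additional intersection occurs at $\theta=0$, where $S_k(1,y)=y^2+(k+2)y+1$ has both roots on the unit circle; these are distinct for $-4<k<0$, and there is a double root at $k=-4$ (namely $y=1$) and at $k=0$ (namely $y=-1$); (4) at $k=2$ the fold points coalesce with the boundary $\theta=\pi$, where $S_2(-1,y)=y^2-1$. *)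

(* Defs.v *)
From HB Require Import structures.
From mathcomp Require Import all_boot all_order all_algebra.
From mathcomp Require Import complex.
From mathcomp Require Import reals trigo.

Set Implicit Arguments.
Unset Strict Implicit.
Unset Printing Implicit Defensive.

Import Order.TTheory GRing.Theory Num.Theory.
Local Open Scope ring_scope.
Local Open Scope complex_scope.

Definition S (R : realType) (k : R) (x y : R[i]) : R[i] :=
  y ^+ 2 + (x ^+ 2 + k%:C * x + 1) * y + x ^+ 3.

(* S_k(x, -) as a polynomial in y, needed to speak of its roots with
   multiplicity; [horner_Spoly] relates it to [S]. *)
Definition Spoly (R : realType) (k : R) (x : R[i]) : {poly R[i]} :=
  'X^2 + (x ^+ 2 + k%:C * x + 1)%:P * 'X + (x ^+ 3)%:P.

Lemma horner_Spoly (R : realType) (k : R) (x y : R[i]) :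
  (Spoly k x).[y] = S k x y.
Proof. by rewrite /Spoly /S !hornerE. Qed.

(* e^(i theta), through Euler's formula *)
Definition expi (R : realType) (theta : R) : R[i] :=
  cos theta +i* sin theta.

(* Main.v *)
Require Import Defs.
From HB Require Import structures.
From mathcomp Require Import all_boot all_order all_algebra.
From mathcomp Require Import complex.
From mathcomp Require Import reals trigo.
From mathcomp Require Import ring lra.

Set Implicit Arguments.
Unset Strict Implicit.
Unset Printing Implicit Defensive.

Import Order.TTheory GRing.Theory Num.Theory.
Local Open Scope ring_scope.
Local Open Scope complex_scope.

(** The middle coefficient of [S k x], as a polynomial in [y], is
    [x ^+ 2 + k x + 1]; when [|x| = 1] it equals [c * x] with the real number
    [c = k + 2 Re x], because [x + x^-1 = 2 Re x] ([middle_coef_unit]).  On the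
    torus the equation is therefore [y ^+ 2 + c x y + x ^+ 3 = 0].  Conjugating
    it (conjugation inverts [x] and [y]) and clearing denominators gives
    [y ^+ 2 + c x ^+ 2 y + x ^+ 3 = 0], and the difference of the two is
    [c x y (x - 1) = 0].  So either [c = 0], or [x = 1].  In the latter case
    the equation is [y + y^-1 = - c], that is [2 Re y = - c], which forces
    [|c| <= 2] ([torus_curve_necessary]).

    Conversely both cases produce two unit roots.  If [c = 0] they are the
    square roots of [- x ^+ 3] ([Spoly_fold_roots]); if [x = 1] and [|c| <= 2]
    they are the conjugate numbers with real part [- c / 2]
    ([Spoly_at1_roots]), which coincide only when [|c| = 2].

    The passage from [x] to the angle is [cos_eq_acos]: in [[-pi, pi]] the
    solutions of [cos theta = t] are [acos t] and [- acos t].  At [t = 1] it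
    identifies [x = 1] with [theta = 0], at [t = - k / 2] it gives the fold
    points and at [t = - 1] their coalescence at [pi]. *)

(** * Unit complex numbers *)

Section UnitComplex.
Variable R : realType.
Implicit Types (t theta : R) (z : R[i]).

Lemma unit_mul_conj z : `|z| = 1 -> z * z^* = 1.
Proof. by move=> z1; rewrite -sqr_normc z1 expr1n. Qed.

Lemma norm1_sqr z : `|z ^+ 2| = 1 -> `|z| = 1.
Proof.
by move=> z1; apply/eqP; rewrite -(pexpr_eq1 (n := 2)) // -normrX z1.
Qed.

Lemma add_conj z : z + z^* = (2 * complex.Re z)%:C.
Proof.
case: z => a b; apply/eqP; rewrite eq_complex /= subrr eqxx andbT.
by apply/eqP; ring.
Qed.

Lemma norm1_ReIm (a b : R) : a ^+ 2 + b ^+ 2 = 1 -> `|a +i* b| = 1.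
Proof. by move=> ab1; rewrite normc_def /= ab1 sqrtr1. Qed.

Lemma unit_ReIm z : `|z| = 1 -> complex.Re z ^+ 2 + complex.Im z ^+ 2 = 1.
Proof.
case: z => a b /unit_mul_conj /eqP; rewrite eq_complex /= => /andP[/eqP <- _].
by ring.
Qed.

Lemma unit_Re_bound z : `|z| = 1 -> -1 <= complex.Re z <= 1.
Proof.
by move=> /unit_ReIm; move: (complex.Re z) (complex.Im z) => a b; nra.
Qed.

Lemma norm_expi theta : `|expi theta| = 1.
Proof. exact/norm1_ReIm/cos2Dsin2. Qed.

(** This holds because [cos] is even and injective on [[0, pi]]. *)
Lemma cos_eq_acos t theta : -1 <= t <= 1 ->
  (- pi <= theta <= pi /\ cos theta = t) <->
  (theta = acos t \/ theta = - acos t).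
Proof.
move=> t1; have acosKt : cos (acos t) = t by apply: acosK; rewrite in_itv.
have a0 := acos_ge0 t1; have api := acos_lepi t1.
split=> [[/andP[ge_pi le_pi] <-]|[]->]; last 2 first.
- by split=> //; lra.
- by split; [lra|rewrite cosN].
have [theta0|/ltW theta0] := leP 0 theta.
  by left; rewrite cosK // in_itv /= theta0.
by right; rewrite cosKN ?opprK // ge_pi.
Qed.

Lemma expi0 : expi (0 : R) = 1.
Proof. by rewrite /expi cos0 sin0. Qed.

Lemma expi_eq1 theta : - pi <= theta <= pi -> expi theta = 1 -> theta = 0.
Proof.
move=> theta_pi [cos1 _]; have := @cos_eq_acos 1 theta.
by rewrite acos1 oppr0 => -[|/(_ (conj theta_pi cos1)) [] //]; lra.
Qed.

End UnitComplex.

(** * Unit roots of the quadratic *)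

Section UnitRoots.
Variable R : realType.
Implicit Types (k : R) (x y z : R[i]).

(** On the unit circle [1 = x * x^*], so [x] factors out of the whole
    coefficient and leaves the real number [k + x + x^*]. *)
Lemma middle_coef_unit k x : `|x| = 1 ->
  x ^+ 2 + k%:C * x + 1 = (k + 2 * complex.Re x)%:C * x.
Proof.
by move=> /unit_mul_conj x1; rewrite rmorphD /= -add_conj -[1 in LHS]x1; ring.
Qed.

Lemma S1E k y : S k 1 y = y ^+ 2 + (k + 2)%:C * y + 1.
Proof. by rewrite /S rmorphD /= rmorph_nat; ring. Qed.

(** The equation and its conjugate differ only in the power of [x] next to
    [y], because the factor [c] is real; comparing them isolates [c (x - 1)]. *)
Lemma torus_curve_necessary k x y : `|x| = 1 -> `|y| = 1 -> S k x y = 0 ->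
  (x = 1 /\ `|k + 2| <= 2) \/ k + 2 * complex.Re x = 0.
Proof.
move=> x1 y1 Sxy; move: (Sxy); rewrite /S middle_coef_unit //.
move: (k + _) => c eq_y.
have [->|c0] := eqVneq c 0; [by right|left].
have xu := unit_mul_conj x1; have yv := unit_mul_conj y1.
(* Multiplying [conj_y] by [y ^+ 2 * x ^+ 3] clears [x^-1] and [y^-1]. *)
have conj_y : y^* ^+ 2 + c%:C * x^* * y^* + x^* ^+ 3 = 0.
  transitivity ((y ^+ 2 + c%:C * x * y + x ^+ 3)^*); last first.
    by rewrite eq_y rmorph0.
  by rewrite -{1}(conjc_real c) !rmorphD !rmorphXn !rmorphM.
have eq_conj : y ^+ 2 + c%:C * x ^+ 2 * y + x ^+ 3 = 0.
  transitivity ((x * x^*) ^+ 3 * y ^+ 2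
    + c%:C * (x * x^*) * (y * y^*) * x ^+ 2 * y + (y * y^*) ^+ 2 * x ^+ 3).
    by rewrite xu yv; ring.
  by rewrite -[RHS](mulr0 (y ^+ 2 * x ^+ 3)) -conj_y; ring.
have x_eq1 : x = 1.
  have : c%:C * x * y * (x - 1) = 0.
    transitivity ((y ^+ 2 + c%:C * x ^+ 2 * y + x ^+ 3)
      - (y ^+ 2 + c%:C * x * y + x ^+ 3)); first by ring.
    by rewrite eq_conj eq_y subrr.
  have unit_neq0 z : `|z| = 1 -> z != 0.
    by rewrite -normr_eq0 => ->; exact: oner_neq0.
  have [x0 y0] := (unit_neq0 x x1, unit_neq0 y y1).
  move/eqP; rewrite !mulf_eq0 (negPf x0) (negPf y0).
  by rewrite fmorph_eq0 (negPf c0) subr_eq0 => /eqP.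
split=> //; move: Sxy; rewrite x_eq1 S1E => eq1.
(* Dividing the equation by [y] turns it into [y + y^* = - (k + 2)]. *)
have : (k + 2 + 2 * complex.Re y)%:C = 0.
  rewrite rmorphD /= -add_conj.
  transitivity (y^* * (y ^+ 2 + (k + 2)%:C * y + 1)); last by rewrite eq1 mulr0.
  transitivity ((k + 2)%:C * (y * y^*) + (y * y^*) * y + y^*); last by ring.
  by rewrite yv; ring.
move/eqP; rewrite fmorph_eq0 => /eqP; have := unit_Re_bound y1.
by rewrite ler_norml; lra.
Qed.

(** Without its middle term the quadratic is [y ^+ 2 + x ^+ 3], whose roots are
    opposite and of modulus [1] because their square is. *)
Lemma Spoly_fold_roots k x : `|x| = 1 -> k + 2 * complex.Re x = 0 ->
  exists y1 y2 : R[i], [/\ Spoly k x = ('X - y1%:P) * ('X - y2%:P),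
    `|y1| = 1 & `|y2| = 1].
Proof.
move=> x1 c0; pose y : R[i] := sqrtC (- x ^+ 3).
have y2 : y ^+ 2 = - x ^+ 3 by rewrite sqrtCK.
have y1 : `|y| = 1 by apply: norm1_sqr; rewrite y2 normrN normrX x1 expr1n.
exists y, (- y); split; rewrite ?normrN //.
rewrite /Spoly middle_coef_unit // c0 mul0r.
by rewrite -[x ^+ 3]opprK -y2 !rmorphN rmorphXn /= rmorph0; ring.
Qed.

(** The quadratic [y ^+ 2 + (k + 2) y + 1] is real with nonpositive
    discriminant, so its roots are conjugate to each other; their product [1]
    is then their squared modulus. *)
Lemma Spoly_at1_roots k : -4 <= k <= 0 ->
  exists y1 y2 : R[i], [/\ Spoly k 1 = ('X - y1%:P) * ('X - y2%:P),
    `|y1| = 1, `|y2| = 1 & -4 < k < 0 -> y1 != y2].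
Proof.
(* [a] is half the sum of the roots; [b] puts [a +i* b] on the unit circle. *)
move=> k40; pose a := - (k + 2) / 2; pose b := Num.sqrt (1 - a ^+ 2).
have b2 : b ^+ 2 = 1 - a ^+ 2 by rewrite sqr_sqrtr // /a; nra.
have y1 : `|a +i* b| = 1 by apply: norm1_ReIm; rewrite b2; ring.
exists (a +i* b), (a +i* b)^*; split; rewrite ?normcJ //.
  have -> : Spoly k 1 = 'X^2 - ((a +i* b) + (a +i* b)^*)%:P * 'X
      + ((a +i* b) * (a +i* b)^*)%:P.
    rewrite unit_mul_conj // add_conj /Spoly /= expr1n mulr1 expr1n.
    have -> : 2 * a = - (k + 2) by rewrite /a; field.
    by ring.
  by rewrite rmorphM rmorphD; ring.
move=> k40s; have b_gt0 : 0 < b by rewrite sqrtr_gt0 /a; nra.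
by rewrite eq_complex /= eqxx /=; apply/eqP => bN; lra.
Qed.

Lemma Spoly_root_S k x y1 y2 :
  Spoly k x = ('X - y1%:P) * ('X - y2%:P) -> S k x y1 = 0.
Proof. by rewrite -horner_Spoly => ->; rewrite !hornerE subrr mul0r. Qed.

(** The criterion depends on the point [x] of the unit circle only; angles
    enter later, through [cos_eq_acos]. *)
Lemma torus_curve_criterion k x : `|x| = 1 ->
  (exists y : R[i], `|y| = 1 /\ S k x y = 0) <->
  (x = 1 /\ `|k + 2| <= 2) \/ k + 2 * complex.Re x = 0.
Proof.
move=> x1; split=> [[y [y1 Sxy]]|]; first exact: torus_curve_necessary Sxy.
case=> [[->]|c0].
  rewrite ler_norml => k2.
  have /Spoly_at1_roots[y1 [y2 [/Spoly_root_S Sy1 norm_y1 _ _]]] : -4 <= k <= 0.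
    lra.
  by exists y1.
have [y1 [y2 [/Spoly_root_S Sy1 norm_y1 _]]] := Spoly_fold_roots x1 c0.
by exists y1.
Qed.

Lemma Spoly_m4 : Spoly (-4 : R) 1 = ('X - 1%:P) ^+ 2.
Proof. by rewrite /Spoly; ring. Qed.

Lemma Spoly_0 : Spoly (0 : R) 1 = ('X - (-1)%:P) ^+ 2.
Proof. by rewrite /Spoly; ring. Qed.

End UnitRoots.

(** * The intersection of the curve with the torus *)

Theorem proposition3p4 (R : realType) (k : R) :
  (* the criterion *)
  (forall theta : R, - pi <= theta <= pi ->
    ((exists y : R[i], `|y| = 1 /\ S k (expi theta) y = 0) <->
     ((theta = 0 /\ `|k + 2| <= 2) \/ k + 2 * cos theta = 0)))
  /\ ((exists theta : R, - pi <= theta <= pi /\ k + 2 * cos theta = 0) <->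
      `|k| <= 2)
  (* (1) *)
  /\ ((exists x y : R[i], [/\ `|x| = 1, `|y| = 1 & S k x y = 0]) <->
      -4 <= k <= 2)
  (* (2) *)
  /\ (-2 <= k <= 2 ->
      (forall theta : R,
        (- pi <= theta <= pi /\ k + 2 * cos theta = 0) <->
        (theta = acos (- k / 2) \/ theta = - acos (- k / 2)))
      /\ (forall theta : R,
        theta = acos (- k / 2) \/ theta = - acos (- k / 2) ->
        [/\ expi theta ^+ 2 + k%:C * expi theta + 1 = 0,
            forall y : R[i],
              S k (expi theta) y = 0 <-> y ^+ 2 = - expi theta ^+ 3
          & exists y1 y2 : R[i],
              [/\ Spoly k (expi theta) = ('X - y1%:P) * ('X - y2%:P),
                  `|y1| = 1 & `|y2| = 1]]))
  (* (3) *)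
  /\ (-4 <= k <= 0 ->
      [/\ exists y : R[i], `|y| = 1 /\ S k (expi 0) y = 0,
          k != -2 -> k + 2 * cos 0 != 0,
          expi (0 : R) = 1,
          forall y : R[i], S k 1 y = y ^+ 2 + (k + 2)%:C * y + 1
        & exists y1 y2 : R[i],
            [/\ Spoly k 1 = ('X - y1%:P) * ('X - y2%:P),
                `|y1| = 1, `|y2| = 1
              & -4 < k < 0 -> y1 != y2]])
  /\ mup 1 (Spoly (-4 : R) 1) = 2%N
  /\ mup (-1) (Spoly (0 : R) 1) = 2%N
  (* (4) *)
  /\ [/\ acos (- 2 / 2) = pi :> R,
         forall theta : R, - pi <= theta <= pi ->
           (2 + 2 * cos theta = 0 <-> (theta = pi \/ theta = - pi)),
         expi (pi : R) = -1,
         expi (- pi : R) = -1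
       & forall y : R[i], S (2 : R) (-1) y = y ^+ 2 - 1].
Proof.
have fold_range theta : -2 <= k <= 2 ->
    (- pi <= theta <= pi /\ k + 2 * cos theta = 0) <->
    (theta = acos (- k / 2) \/ theta = - acos (- k / 2)).
  move=> k2; rewrite -cos_eq_acos; last lra.
  by split=> -[theta_pi eq_cos]; split=> //; lra.
split; [|split; [|split; [|split; [|split; [|split; [|split]]]]]].
- move=> theta theta_pi; rewrite torus_curve_criterion ?norm_expi //.
  split=> -[[]|]; try by right.
    by move=> /(expi_eq1 theta_pi) -> k2; left.
  by move=> -> k2; left; rewrite expi0.
- split=> [[theta [_ eq_cos]]|].
    by have := cos_geN1 theta; have := cos_le1 theta; rewrite ler_norml; lra.
  rewrite ler_norml => k2; exists (acos (- k / 2)).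
  by apply/fold_range; [|left].
- split=> [[x [y [x1 y1 Sxy]]]|k42].
    have := unit_Re_bound x1.
    by case: (torus_curve_necessary x1 y1 Sxy) => [[_]|]; rewrite ?ler_norml; lra.
  have [k0|k0] := leP k 0.
    have k20 : `|k + 2| <= 2 by rewrite ler_norml; lra.
    have [|y [y1 Sy]] := (torus_curve_criterion k (normr1 R[i])).2.
      by left.
    by exists 1, y; rewrite normr1.
  have [_ c0] : - pi <= acos (- k / 2) <= pi
      /\ k + 2 * cos (acos (- k / 2)) = 0.
    by apply/fold_range; [lra|left].
  have [|y [y1 Sy]] := (torus_curve_criterion k (norm_expi (acos (- k / 2)))).2.
    by right.
  by exists (expi (acos (- k / 2))), y; rewrite norm_expi.
- move=> k2; split=> [theta|theta /fold_range -/(_ k2)[_ c0]].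
    exact: fold_range.
  have mid0 : expi theta ^+ 2 + k%:C * expi theta + 1 = 0.
    by rewrite middle_coef_unit ?norm_expi // c0 mul0r.
  split=> // [y|]; last exact: (Spoly_fold_roots (norm_expi theta)).
  rewrite /S mid0 mul0r addr0.
  by split=> [/eqP|->]; [rewrite addr_eq0 => /eqP|rewrite addNr].
- move=> k40; have [y1 [y2 [Sk norm1 norm2 neq]]] := Spoly_at1_roots k40.
  split; last by exists y1, y2.
  + by exists y1; rewrite expi0; split=> //; apply: Spoly_root_S Sk.
  + by rewrite cos0 mulr1 addr_eq0.
  + exact: expi0.
  + exact: S1E.
- by rewrite Spoly_m4 mup_XsubCX eqxx.
- by rewrite Spoly_0 mup_XsubCX eqxx.
split.
- have -> : - 2 / 2 = -1 :> R by field.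
  exact: acosN1.
- move=> theta theta_pi.
  have := @cos_eq_acos R (-1) theta; rewrite acosN1 => <-; last lra.
  by split=> [eq_cos|[_]]; [split=> //|]; lra.
- by rewrite /expi cospi sinpi; apply/eqP; rewrite eq_complex /= oppr0 !eqxx.
- rewrite /expi cosN sinN cospi sinpi.
  by apply/eqP; rewrite eq_complex /= oppr0 !eqxx.
- by move=> y; rewrite /S rmorph_nat; ring.
Qed.
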